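(* For every integer $n\geq 2$ and all real numbers $p\geq 1$ and $q\geq 1$, the norm $\operatorname{cl}_{\nu_n,p,q}$ on the commutator subgroup $[B_\infty,B_\infty]$ of the infinite braid group is equivalent to (the restriction to $[B_\infty,B_\infty]$ of) the biinvariant word norm $\|\cdot\|$. That is, there exist constants $0<c\leq C<\infty$ such that $c\,\|\alpha\|\leq \operatorname{cl}_{\nu_n,p,q}(\alpha)\leq C\,\|\alpha\|$ for all $\alpha\in[B_\infty,B_\infty]$.
   Context: $B_n$ denotes the braid group on $n$ strands with standard Artin generators $\sigma_1,\dots,\sigma_{n-1}$. Via the standard inclusions $B_n\to B_{n+1}$, $\sigma_i\mapsto\sigma_i$ (adding a trivial string), put $B_\infty=\bigcup_{n\ge 1}B_n$. Commutators are $[a,b]=aba^{-1}b^{-1}$, and $[B_\infty,B_\infty]$ is the commutator subgroup. A conjugation-invariant norm on a group $G$ is a function $\nu:G\to\mathbb{R}_{\ge0}$ with $\nu(1)=0$, $\nu(f)>0$ for $f\neq1$, $\nu(f^{-1})=\nu(f)$, $\nu(fg)\le\nu(f)+\nu(g)$ and $\nu(gfg^{-1})=\nu(f)$ for all $f,g\in G$. Two norms on a group are equivalent if their ratio (on nontrivial elements) is bounded away from $0$ and $\infty$. For a group $G$ normally generated by a subset $K\subset G$, define $q_K(f)$ to be the minimal $l\ge0$ such that $f=(g_1k_1g_1^{-1})\cdots(g_lk_lg_l^{-1})$ for some $k_i\in K$, $g_i\in G$ (the identity being the empty product). On $B_\infty$, for $n\ge2$, set $\nu_n=q_{B_n}$,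 and set $\|\cdot\|=q_{\{\sigma_1,\sigma_1^{-1}\}}$, the biinvariant word norm. For a group $G$ with a conjugation-invariant norm $\nu$ and real numbers $p,q>0$, let $[G,G]_{\nu,p,q}$ be the subgroup of $G$ generated by all commutators $[f,g]$ with $f,g\in G$, $\nu(f)\le p$, $\nu(g)\le q$. For $h\in[G,G]_{\nu,p,q}$, let $\operatorname{cl}_{\nu,p,q}(h)$ be the minimal $k\ge0$ such that $h=[f_1,g_1]\cdots[f_k,g_k]$ for some $f_i,g_i\in G$ with $\nu(f_i)\le p$ and $\nu(g_i)\le q$ for all $i$. For $G=B_\infty$, $n\ge2$ and $p,q\ge1$ one has $[B_\infty,B_\infty]_{\nu_n,p,q}=[B_\infty,B_\infty]$, so $\operatorname{cl}_{\nu_n,p,q}$ is a norm on $[B_\infty,B_\infty]$. *)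

(* Defs.v *)
From HB Require Import structures.
From mathcomp Require Import all_boot all_order all_algebra.
From mathcomp Require Import generic_quotient.
From mathcomp Require Import boolp classical_sets reals.

Set Implicit Arguments.
Unset Strict Implicit.
Unset Printing Implicit Defensive.

Import Order.TTheory GRing.Theory Num.Theory.
Local Open Scope quotient_scope.
Local Open Scope group_scope.

(* The letter (i, false) stands for the Artin generator sigma_(i+1) and
   (i, true) for its inverse. *)
Definition word : Type := seq (nat * bool).
HB.instance Definition _ := Choice.on word.

(* w is a word in sigma_1^+-1, ..., sigma_(n-1)^+-1. *)
Definition braid_word (n : nat) (w : word) : bool := all (fun l => l.1.+1 < n)%N w.

(* Equality in B_n: Artin's presentation, i.e. the smallest congruence on
   braid words on n strands containing free cancellation and the braid
   relations. *)
Inductive braid_eq (n : nat) : word -> word -> Prop :=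
| braid_eq_refl w : braid_word n w -> braid_eq n w w
| braid_eq_sym u v : braid_eq n u v -> braid_eq n v u
| braid_eq_trans u v w : braid_eq n u v -> braid_eq n v w -> braid_eq n u w
| braid_eq_cat u u' v v' :
    braid_eq n u u' -> braid_eq n v v' -> braid_eq n (u ++ v) (u' ++ v')
| braid_eq_cancel i b : (i.+1 < n)%N -> braid_eq n [:: (i, b); (i, ~~ b)] [::]
| braid_eq_far i j : (i.+1 < j)%N -> (j.+1 < n)%N ->
    braid_eq n [:: (i, false); (j, false)] [:: (j, false); (i, false)]
| braid_eq_artin i : (i.+2 < n)%N ->
    braid_eq n [:: (i, false); (i.+1, false); (i, false)]
               [:: (i.+1, false); (i, false); (i.+1, false)].

Lemma braid_word_leq m n w : (m <= n)%N -> braid_word m w -> braid_word n w.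
Proof. by move=> mn; apply: sub_all => l /leq_trans; apply. Qed.

Lemma braid_eq_leq m n u v : (m <= n)%N -> braid_eq m u v -> braid_eq n u v.
Proof.
move=> mn; elim=> {u v}.
- by move=> w /(braid_word_leq mn); apply: braid_eq_refl.
- by move=> u v _; apply: braid_eq_sym.
- by move=> u v w _ uv _; apply: braid_eq_trans.
- by move=> u u' v v' _ uu' _; apply: braid_eq_cat.
- by move=> i b /leq_trans/(_ mn); apply: braid_eq_cancel.
- by move=> i j ij /leq_trans/(_ mn); apply: braid_eq_far.
- by move=> i /leq_trans/(_ mn); apply: braid_eq_artin.
Qed.

Lemma braid_wordP w : exists n, braid_word n w.
Proof.
elim: w => [|[i b] w [n wn]]; first by exists 0%N.
exists (maxn i.+2 n); rewrite /braid_word /= leq_maxl /=.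
exact: braid_word_leq (leq_maxr _ _) wn.
Qed.

(* B_oo is the direct limit of the B_n along the inclusions
   sigma_i |-> sigma_i: every word is a braid word for n large, and two words
   represent the same element iff they already do in some B_n. *)
Definition braid_eq_infty (u v : word) : bool := `[< exists n, braid_eq n u v >].

Lemma braid_eq_infty_refl : reflexive braid_eq_infty.
Proof.
by move=> w; have [n wn] := braid_wordP w; apply/asboolP; exists n; exact: braid_eq_refl.
Qed.

Lemma braid_eq_infty_sym : symmetric braid_eq_infty.
Proof.
by move=> u v; apply/asboolP/asboolP => -[n uv]; exists n; exact: braid_eq_sym.
Qed.

Lemma braid_eq_infty_trans : transitive braid_eq_infty.
Proof.
move=> v u w /asboolP[m uv] /asboolP[n vw]; apply/asboolP; exists (maxn m n).
by apply: (@braid_eq_trans _ _ v);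
  [exact: braid_eq_leq (leq_maxl _ _) uv | exact: braid_eq_leq (leq_maxr _ _) vw].
Qed.

Canonical braid_eq_infty_equiv :=
  EquivRel braid_eq_infty braid_eq_infty_refl braid_eq_infty_sym braid_eq_infty_trans.

Lemma braid_eq_infty_cat u u' v v' :
  braid_eq_infty u u' -> braid_eq_infty v v' -> braid_eq_infty (u ++ v) (u' ++ v').
Proof.
move=> /asboolP[m uu'] /asboolP[n vv']; apply/asboolP; exists (maxn m n).
by apply: braid_eq_cat;
  [exact: braid_eq_leq (leq_maxl _ _) uu' | exact: braid_eq_leq (leq_maxr _ _) vv'].
Qed.

Definition word_inv (w : word) : word := rev [seq (l.1, ~~ l.2) | l <- w].

Lemma word_invK : involutive word_inv.
Proof.
move=> w; rewrite /word_inv map_rev revK -map_comp -[RHS]map_id.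
by apply: eq_map => -[i b] /=; rewrite negbK.
Qed.

Lemma braid_eq_infty_mulV w : braid_eq_infty (w ++ word_inv w) [::].
Proof.
elim: w => [|[i b] w IH]; first exact: braid_eq_infty_refl.
rewrite /word_inv /= rev_cons -cats1 -/(word_inv w) catA.
apply: (@braid_eq_infty_trans ([:: (i, b)] ++ [::] ++ [:: (i, ~~ b)])).
  rewrite -cat1s; apply: braid_eq_infty_cat; first exact: braid_eq_infty_refl.
  by apply: braid_eq_infty_cat IH _; exact: braid_eq_infty_refl.
by apply/asboolP; exists i.+2; exact: braid_eq_cancel.
Qed.

Lemma braid_eq_infty_Vmul w : braid_eq_infty (word_inv w ++ w) [::].
Proof. by rewrite -{2}[w]word_invK braid_eq_infty_mulV. Qed.

Lemma braid_eq_infty_inv u v :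
  braid_eq_infty u v -> braid_eq_infty (word_inv u) (word_inv v).
Proof.
move=> uv; apply: (@braid_eq_infty_trans (word_inv u ++ (v ++ word_inv v))).
  rewrite -[X in braid_eq_infty X]cats0.
  apply: braid_eq_infty_cat; first exact: braid_eq_infty_refl.
  by rewrite braid_eq_infty_sym braid_eq_infty_mulV.
rewrite catA -[X in braid_eq_infty _ X]cat0s.
apply: braid_eq_infty_cat; last exact: braid_eq_infty_refl.
apply: (braid_eq_infty_trans _ (braid_eq_infty_Vmul u)).
by apply: braid_eq_infty_cat; [exact: braid_eq_infty_refl | rewrite braid_eq_infty_sym].
Qed.

Definition braid_infty : Type := {eq_quot braid_eq_infty}.
HB.instance Definition _ := Choice.on braid_infty.
HB.instance Definition _ : EqQuotient word braid_eq_infty braid_infty :=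
  EqQuotient.on braid_infty.

Definition braid_class (w : word) : braid_infty := \pi w.

Lemma braid_classP u v :
  braid_class u = braid_class v <-> exists n, braid_eq n u v.
Proof.
by split=> [/eqP|uv]; [|apply/eqP]; rewrite /braid_class eqmodE => *; apply/asboolP.
Qed.

Lemma braid_class_repr x : braid_class (repr x) = x.
Proof. exact: reprK. Qed.

Definition braid_one : braid_infty := braid_class [::].
Definition braid_mul (x y : braid_infty) : braid_infty :=
  braid_class (repr x ++ repr y).
Definition braid_inv (x : braid_infty) : braid_infty :=
  braid_class (word_inv (repr x)).

Lemma braid_repr_eq w : braid_eq_infty (repr (braid_class w)) w.
Proof. by apply/asboolP/braid_classP; rewrite braid_class_repr. Qed.

Lemma braid_mul_class u v :
  braid_mul (braid_class u) (braid_class v) = braid_class (u ++ v).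
Proof. by apply/braid_classP/asboolP; apply: braid_eq_infty_cat; exact: braid_repr_eq. Qed.

Lemma braid_inv_class u : braid_inv (braid_class u) = braid_class (word_inv u).
Proof. by apply/braid_classP/asboolP; apply: braid_eq_infty_inv; exact: braid_repr_eq. Qed.

Fact braid_mulA : associative braid_mul.
Proof.
move=> x y z; rewrite -(braid_class_repr x) -(braid_class_repr y) -(braid_class_repr z).
by rewrite !braid_mul_class catA.
Qed.

Fact braid_mul1 : left_id braid_one braid_mul.
Proof. by move=> x; rewrite -(braid_class_repr x) braid_mul_class. Qed.

Fact braid_mulr1 : right_id braid_one braid_mul.
Proof. by move=> x; rewrite -(braid_class_repr x) braid_mul_class cats0. Qed.

Fact braid_mulV : left_inverse braid_one braid_inv braid_mul.
Proof.
move=> x; rewrite -(braid_class_repr x) braid_inv_class braid_mul_class.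
by apply/braid_classP/asboolP; exact: braid_eq_infty_Vmul.
Qed.

Fact braid_mulrV : right_inverse braid_one braid_inv braid_mul.
Proof.
move=> x; rewrite -(braid_class_repr x) braid_inv_class braid_mul_class.
by apply/braid_classP/asboolP; exact: braid_eq_infty_mulV.
Qed.

HB.instance Definition _ := isGroup.Build braid_infty
  braid_mulA braid_mul1 braid_mulr1 braid_mulV braid_mulrV.

(* B_n as a subset of B_oo. *)
Definition braid_sub (n : nat) : set braid_infty :=
  [set x | exists2 w, braid_word n w & x = braid_class w].

(* sigma i is the Artin generator sigma_(i+1). *)
Definition sigma (i : nat) : braid_infty := braid_class [:: (i, false)].

Lemma braid_class_cat u v : braid_class (u ++ v) = braid_class u * braid_class v.
Proof. by rewrite -braid_mul_class. Qed.

Lemma braid_class_letter i b :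
  braid_class [:: (i, b)] = if b then (sigma i)^-1 else sigma i.
Proof. by case: b => //; rewrite -[RHS]/(braid_inv _) braid_inv_class. Qed.

Lemma sigma_artin i :
  sigma i * sigma i.+1 * sigma i = sigma i.+1 * sigma i * sigma i.+1.
Proof.
have sss j k l : sigma j * sigma k * sigma l =
    braid_class [:: (j, false); (k, false); (l, false)].
  by rewrite (braid_class_cat [:: _; _] [:: _]) (braid_class_cat [:: _] [:: _]).
by rewrite !sss; apply/braid_classP; exists i.+3; exact: braid_eq_artin.
Qed.

Lemma sigma_conj i : exists g, sigma i = g * sigma 0 * g^-1.
Proof.
elim: i => [|i [g sg]]; first by exists 1; rewrite mul1g invg1 mulg1.
exists (sigma i * sigma i.+1 * g).
have -> : sigma i * sigma i.+1 * g * sigma 0 * (sigma i * sigma i.+1 * g)^-1 =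
    sigma i * sigma i.+1 * (g * sigma 0 * g^-1) * (sigma i * sigma i.+1)^-1.
  by rewrite (invgM (sigma i * sigma i.+1) g) !mulgA.
by rewrite -sg sigma_artin -(mulgA (sigma i.+1)) mulgK.
Qed.

(* The least element of P; the value 0 for empty P is a default. *)
Definition min_nat (P : set nat) : nat :=
  if pselect (exists k, `[< P k >]) is left exP then ex_minn exP else 0%N.

Lemma min_natP (P : set nat) :
  P !=set0%classic -> P (min_nat P) /\ forall k, P k -> (min_nat P <= k)%N.
Proof.
case=> k Pk; rewrite /min_nat; case: pselect => [exP|[]]; last first.
  by exists k; exact/asboolP.
by case: ex_minnP => m /asboolP Pm minm; split=> // j Pj; apply/minm/asboolP.
Qed.

Section Norms.
Variable G : groupType.
Implicit Types (f g h : G) (K S : set G).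

(* The library's [~ f, g] is f^-1 * g^-1 * f * g. *)
Definition comm f g : G := f * g * f^-1 * g^-1.

Definition is_subgroup S : Prop :=
  [/\ S 1, forall f g, S f -> S g -> S (f * g) & forall f, S f -> S f^-1].

Definition gen_subgroup S : set G := smallest is_subgroup S.

Definition comm_subgroup : set G :=
  gen_subgroup [set h | exists f g, h = comm f g].

Definition conj_lengths K f : set nat :=
  [set l | exists g k : 'I_l -> G,
    (forall i, K (k i)) /\ f = \prod_(i < l) (g i * k i * (g i)^-1)].

(* Intended for K normally generating G, so that no set of lengths is empty;
   see word_norm_attained and braid_nu_attained. *)
Definition conj_norm K f : nat := min_nat (conj_lengths K f).

Variables (R : realType) (nu : G -> R) (p q : R).

(* [G, G]_(nu, p, q) *)
Definition bounded_comm_subgroup : set G :=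
  gen_subgroup [set h | exists f g,
    [/\ (nu f <= p)%R, (nu g <= q)%R & h = comm f g]].

Definition comm_lengths h : set nat :=
  [set k | exists f g : 'I_k -> G,
    (forall i, (nu (f i) <= p)%R /\ (nu (g i) <= q)%R) /\
    h = \prod_(i < k) comm (f i) (g i)].

(* Intended for h in bounded_comm_subgroup: elsewhere comm_lengths h is empty
   and the value is the default 0. *)
Definition cl h : nat := min_nat (comm_lengths h).

End Norms.

Definition braid_nu (R : realType) (n : nat) (x : braid_infty) : R :=
  (conj_norm (braid_sub n) x)%:R%R.

Definition word_norm (x : braid_infty) : nat :=
  conj_norm [set sigma 0; (sigma 0)^-1]%classic x.

Lemma conj_lengths_cons (G : groupType) (K : set G) g k f l :
  K k -> conj_lengths K f l -> conj_lengths K (g * k * g^-1 * f) l.+1.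
Proof.
move=> Kk [gs [ks [Kks ->]]].
exists (fun i => oapp gs g (unlift ord0 i)), (fun i => oapp ks k (unlift ord0 i)).
split; first by move=> i; case: unlift.
rewrite big_ord_recl unlift_none; congr (_ * _).
by apply: eq_bigr => i _; rewrite liftK.
Qed.

Lemma sigma_normally_generates (K : set braid_infty) x :
  K (sigma 0) -> K (sigma 0)^-1 -> conj_lengths K x !=set0%classic.
Proof.
move=> Ks KsV; rewrite -(braid_class_repr x); elim: (repr x) => [|[i b] w [l wl]].
  by exists 0%N; exists (fun=> 1), (fun=> sigma 0); split=> //; rewrite big_ord0.
exists l.+1; rewrite -cat1s braid_class_cat braid_class_letter.
have [g ->] := sigma_conj i; case: b; last exact: conj_lengths_cons.
by rewrite !invgM invgK mulgA; exact: conj_lengths_cons.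
Qed.

Lemma word_norm_attained x :
  conj_lengths [set sigma 0; (sigma 0)^-1]%classic x (word_norm x).
Proof.
by apply: (min_natP (sigma_normally_generates _ _ _)).1; [left | right].
Qed.

Lemma braid_nu_attained n x : (2 <= n)%N ->
  conj_lengths (braid_sub n) x (conj_norm (braid_sub n) x).
Proof.
move=> n2; apply: (min_natP (sigma_normally_generates _ _ _)).1.
  by exists [:: (0%N, false)]; rewrite // /braid_word /= n2.
exists [:: (0%N, true)]; first by rewrite /braid_word /= n2.
by rewrite braid_class_letter.
Qed.

(* Main.v *)
Require Import Defs.
From mathcomp Require Import all_boot all_order all_algebra.
From mathcomp Require Import boolp classical_sets reals.

(** Lower bound: given [k] in [B_n] and any [x], some conjugate [g] of a fixed
    braid (depending only on [n]) moves the first [n] strands beyond the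
    support of [x], so [g k g^-1] commutes with [x] and [[k, x] = [[k, g], x]]
    is a product of four conjugates of [g] and its inverse.

    Upper bound: for conjugates [x], [y] of [sigma 0], the braid [x y^-1] is a
    product of four commutators of conjugates of [sigma 0]. Indeed
    [sigma i (sigma i.+1)^-1] is one such commutator by Artin's relation, hence
    [sigma 0 (sigma 2)^-1] is a product of two; and [(sigma 0, sigma N)] is
    conjugate both to [(sigma 0, sigma 2)] and, for [N] large, to
    [(y, sigma N)]. Replacing the letters one by one, a product of [l]
    conjugates of [sigma 0] and its inverse is, up to a power of [sigma 0], a
    product of [4 l] such commutators, and the power is trivial when the
    exponent sum vanishes. *)

Set Implicit Arguments.
Unset Strict Implicit.
Unset Printing Implicit Defensive.

Import Order.TTheory GRing.Theory Num.Theory.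
Local Open Scope group_scope.

(** * Products of a given length, conjugates and commutators *)

Section ProductLength.
Variable G : groupType.
Implicit Types (S K : set G) (x y g f s : G).

(** An inductive common form of [conj_lengths] and [comm_lengths]; the length is exact, not an upper
    bound. *)
Inductive prod_length S : nat -> G -> Prop :=
| prod_length0 : prod_length S 0 1
| prod_lengthS s l x :
    S s -> prod_length S l x -> prod_length S l.+1 (s * x).

Lemma prod_lengthP S l x :
  prod_length S l x <->
  exists F : 'I_l -> G, (forall i, S (F i)) /\ x = \prod_(i < l) F i.
Proof.
split.
  elim=> [|s {}l {}x Ss _ [F [SF ->]]].
    by exists (fun=> 1); split=> [[]|] //; rewrite big_ord0.
  exists (fun i => oapp F s (unlift ord0 i)); split=> [i|].
    by case: unlift.
  rewrite big_ord_recl unlift_none; congr (_ * _).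
  by apply: eq_bigr => i _; rewrite liftK.
elim: l x => [|l IH] x [F [SF ->]]; first by rewrite big_ord0; exact: prod_length0.
rewrite big_ord_recl; apply: prod_lengthS; first exact: SF.
by apply: IH; exists (fun i => F (lift ord0 i)).
Qed.

Definition conj_closed S := forall s g, S s -> S (s ^ g).
Definition inv_closed S := forall s, S s -> S s^-1.

Lemma prod_length1 S s : S s -> prod_length S 1 s.
Proof. by move=> Ss; rewrite -[s]mulg1; apply/prod_lengthS/prod_length0. Qed.

Lemma prod_lengthM S l m x y :
  prod_length S l x -> prod_length S m y -> prod_length S (l + m) (x * y).
Proof.
move=> + Sy; elim=> [|s {}l {}x Ss _ IH]; first by rewrite mul1g.
by rewrite -mulgA; exact: prod_lengthS.
Qed.

Lemma prod_lengthJ S l x g :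
  conj_closed S -> prod_length S l x -> prod_length S l (x ^ g).
Proof.
move=> SJ; elim=> [|s {}l {}x Ss _ IH]; first by rewrite conj1g; exact: prod_length0.
by rewrite conjMg; apply: prod_lengthS => //; exact: SJ.
Qed.

Lemma prod_lengthV S l x :
  inv_closed S -> prod_length S l x -> prod_length S l x^-1.
Proof.
move=> SV; elim=> [|s {}l {}x Ss _ IH]; first by rewrite invg1; exact: prod_length0.
by rewrite invgM -addn1; apply/prod_lengthM/prod_length1/SV.
Qed.

Lemma prod_length_sub S S' l x :
  (forall s, S s -> S' s) -> prod_length S l x -> prod_length S' l x.
Proof.
move=> SS'; elim=> [|s {}l {}x Ss _ IH]; first exact: prod_length0.
by apply: prod_lengthS => //; exact: SS'.
Qed.

Lemma prod_length_subst S S' l m x :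
  (forall s, S s -> exists2 j, (j <= m)%N & prod_length S' j s) ->
  prod_length S l x -> exists2 j, (j <= l * m)%N & prod_length S' j x.
Proof.
move=> SS'; elim=> [|s {}l {}x Ss _ [j jle S'x]]; first by exists 0%N => //; exact: prod_length0.
have [i ile S's] := SS' s Ss; exists (i + j)%N; last exact: prod_lengthM.
by rewrite mulSn leq_add.
Qed.

Definition conjugates K : set G :=
  [set x | exists g k, K k /\ x = k ^ g]%classic.

Lemma conjugates_conj_closed K : conj_closed (conjugates K).
Proof.
by move=> _ h [g [k [Kk ->]]]; exists (g * h), k; rewrite conjgM.
Qed.

Lemma conjugates_inv_closed K : inv_closed K -> inv_closed (conjugates K).
Proof.
by move=> KV _ [g [k [/KV Kk ->]]]; exists g, k^-1; rewrite conjVg.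
Qed.

Lemma conj_lengthsP K x l : conj_lengths K x l <-> prod_length (conjugates K) l x.
Proof.
split=> [[g [k [Kk ->]]]|].
  apply/prod_lengthP; exists (fun i => k i ^ (g i)^-1); split=> [i|].
    by exists (g i)^-1, (k i).
  by apply: eq_bigr => i _; rewrite conjgE invgK mulgA.
elim=> [|_ {}l {}x [g [k [Kk ->]]] _].
  exists (fun=> 1), (fun=> 1); split; first by case.
  by rewrite big_ord0.
by move=> /(conj_lengths_cons (g^-1) Kk); rewrite invgK conjgE mulgA.
Qed.

Lemma commVE f g : (comm f g)^-1 = comm g f.
Proof. by rewrite /comm !invgM !invgK !mulgA. Qed.

Lemma commJ f g h : comm f g ^ h = comm (f ^ h) (g ^ h).
Proof. by rewrite /comm !conjMg !conjVg. Qed.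

Lemma commM s f x : comm (s * f) x = comm f x ^ s^-1 * comm s x.
Proof. by rewrite /comm conjgE invgK invgM !mulgA !mulgVK. Qed.

Lemma comm1 x : comm 1 x = 1.
Proof. by rewrite /comm mul1g invg1 mulg1 mulgV. Qed.

(** By [commM] the factors of [f] split off one at a time. Conjugation turns a factor [k ^ g] back
    into [k] at the price of changing [x], so the hypothesis on [comm k y] is uniform in [y]. *)
Lemma prod_length_comm K S l m f x :
    conj_closed S ->
    (forall k y, K k -> prod_length S m (comm k y)) ->
  prod_length (conjugates K) l f -> prod_length S (l * m) (comm f x).
Proof.
move=> SJ Sm; elim=> [|_ {}l {}f [g [k [Kk ->]]] _ IH].
  by rewrite comm1; exact: prod_length0.
rewrite mulSn addnC commM; apply: prod_lengthM; first exact: prod_lengthJ.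
by rewrite -[x](conjgKV g) -commJ; apply/prod_lengthJ/Sm.
Qed.

(** Here [comm k g] is [k] times the inverse of [k ^ g^-1], and the second factor commutes with
    [x]. *)
Lemma comm_displace k x g : commute (k ^ g^-1) x -> comm k x = comm (comm k g) x.
Proof.
move=> kgx; have -> : comm k g = k * (k ^ g^-1)^-1.
  by rewrite /comm conjgE invgK !invgM invgK !mulgA.
rewrite commM; have -> : comm (k ^ g^-1)^-1 x = 1.
  by rewrite /comm invgK -(commuteV (commute_sym kgx)) mulgVK mulgV.
by rewrite conj1g mul1g.
Qed.

Lemma prod_length_comm_displace S m k x g :
    conj_closed S -> inv_closed S -> prod_length S m g ->
    commute (k ^ g^-1) x ->
  prod_length S (m + m + (m + m)) (comm k x).
Proof.
move=> SJ SV Sg /comm_displace ->.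
have Skg : prod_length S (m + m) (comm k g).
  have -> : comm k g = g ^ k^-1 * g^-1 by rewrite conjgE invgK mulgA.
  by apply: prod_lengthM; [exact: prod_lengthJ | exact: prod_lengthV].
set h := comm k g in Skg *.
have -> : comm h x = h * (h^-1 ^ x^-1) by rewrite conjgE invgK !mulgA.
by apply: prod_lengthM => //; apply/prod_lengthJ/prod_lengthV.
Qed.

End ProductLength.

(** * Shifting strands *)

Lemma sigma_far i j : (i.+1 < j)%N -> commute (sigma i) (sigma j).
Proof.
move=> ij; rewrite /commute -!braid_class_cat.
by apply/braid_classP; exists j.+2; exact: braid_eq_far.
Qed.

Lemma braid_sub_exists x : exists N, braid_sub N x.
Proof.
have [N wN] := braid_wordP (repr x); exists N, (repr x) => //.
by rewrite braid_class_repr.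
Qed.

Lemma commute_braid_sub N c x :
    (forall i, (i.+1 < N)%N -> commute c (sigma i)) ->
  braid_sub N x -> commute c x.
Proof.
move=> cs [w + ->]; elim: w => [_|[i b] w IH /= /andP[iN wN]]; first exact: commute1.
rewrite -cat1s braid_class_cat braid_class_letter; apply: commuteM (IH wN).
by case: b; [apply: commuteV|]; exact: cs.
Qed.

Lemma commute_conjg (G : groupType) (x y : G) : commute x y -> x ^ y = x.
Proof. by move=> xy; rewrite conjgE xy mulKg. Qed.

Lemma sigma_conj_pair i :
  sigma i ^ ((sigma i.+1)^-1 * (sigma i)^-1) = sigma i.+1.
Proof.
by rewrite conjgE !invgM !invgK !mulgA sigma_artin !mulgK.
Qed.

(* [(sigma a * ... * sigma (a + m))^-1]; the factor next to [sigma (a + m)] is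
   split off because it fixes [sigma (a + m).+1]. *)
Lemma shift1 a m : exists t,
  [/\ forall i, (i.+1 < a)%N -> sigma i ^ t = sigma i,
      forall i, (a + m < i)%N -> sigma i ^ t = sigma i &
      forall i, (a <= i < a + m)%N ->
        sigma i ^ ((sigma (a + m))^-1 * t) = sigma i.+1].
Proof.
have far i j : (i.+1 < j)%N -> sigma i ^ (sigma j)^-1 = sigma i.
  by move=> /sigma_far ij; apply/commute_conjg/commuteV.
have far' i j : (i.+1 < j)%N -> sigma j ^ (sigma i)^-1 = sigma j.
  by move=> /sigma_far ij; apply/commute_conjg/commuteV/commute_sym.
elim: m => [|m [t [t1 t2 t3]]].
  exists 1; split=> [i _|i _|i]; rewrite ?conjg1 //.
  by rewrite addn0 leqNgt => /andP[/negP].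
exists ((sigma (a + m))^-1 * t); rewrite addnS; split=> [i ia|i ia|i].
- by rewrite conjgM far ?t1 // (leq_trans ia) ?leq_addr.
- by rewrite conjgM far' ?t2 // ltnW.
(* For the new index [a + m], the two leading factors produce [sigma (a + m).+1], which [t] fixes.
   Smaller indices commute with the new leading factor. *)
rewrite ltnS => /andP[ai]; rewrite leq_eqVlt => /predU1P[->|iam].
  by rewrite mulgA conjgM sigma_conj_pair t2.
by rewrite conjgM far ?t3 ?ai.
Qed.

(** One cycle [u] raises indices by one; its [d]-th power is taken. The cycle has length parameter
    [m + d], so that an index stays in range through all [d] steps. *)
Lemma shift a m d : exists t,
  (forall i, (i.+1 < a)%N -> sigma i ^ t = sigma i) /\
  (forall i, (i < m)%N -> sigma (a + i) ^ t = sigma (a + i + d)).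
Proof.
have [t [t1 _ t3]] := shift1 a (m + d); set u := _ * t in t3.
have fixu i : (i.+1 < a)%N -> sigma i ^ u = sigma i.
  move=> ia; rewrite conjgM [sigma i ^ _]commute_conjg ?t1 //.
  by apply/commuteV/sigma_far/(leq_trans ia)/leq_addr.
exists (u ^+ d); split=> i im.
  by elim: (d) => [|e IH]; rewrite ?conjg1 // expgS conjgM fixu.
(* The induction is on the number [e <= d] of steps, while the [d] inside [u] stays fixed. *)
have: (d <= d)%N by [].
elim: {1 3 4}d => [|e IH] ed; first by rewrite conjg1 addn0.
rewrite expgSr conjgM IH ?(ltnW ed) // t3 ?addnS // -addnA leq_addr ltn_add2l.
by rewrite -addnS leq_add // ltnW.
Qed.

(** The braid [t] moves [B_n] just past itself, and [u] fixes [B_n] but pushes that copy beyond the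
    support of [x]. Thus [t ^ u] moves [B_n] far away, and only the conjugator [u] depends on
    [x]. *)
Lemma displacement n : exists g0, forall k, braid_sub n k -> forall x,
  exists h, commute (k ^ (g0 ^ h)^-1) x.
Proof.
have [t [_ t0]] := shift 0 n n; exists t^-1 => k Bk x.
have [N xN] := braid_sub_exists x; have [u [u1 u2]] := shift n n N.
exists u; rewrite -conjVg invgK.
have tu i : (i.+1 < n)%N -> sigma i ^ (t ^ u) = sigma (n + i + N).
  move=> i_n; have i_n' := ltnW i_n.
  by rewrite -{1}(u1 i i_n) -conjJg -[i in LHS]add0n t0 // add0n addnC u2.
set v := t ^ u in tu *; apply: commute_sym.
suff kv j : (j.+1 < N)%N -> commute (k ^ v) (sigma j).
  by apply/commute_sym/(commute_braid_sub kv).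
(* Pulling back by [v] reduces the claim to commutation of [c] with the generators of [B_n]. *)
move=> jN; rewrite -[sigma j](conjgKV v); set c := sigma j ^ v^-1.
have ck : commute c k.
  apply: commute_braid_sub Bk => i i_n; apply: (@conjg_inj _ v).
  rewrite [LHS]conjMg [RHS]conjMg conjgKV tu //; apply: sigma_far.
  by rewrite (leq_trans jN) ?leq_addl.
by rewrite /commute -!conjMg ck.
Qed.

(** * Exponent sum *)

Definition word_exponent_sum (w : word) : int :=
  (\sum_(l <- w) (if l.2 then -1 else 1))%R.

(** The abelianization map; independence of the representative is [exponent_sum_class]. *)
Definition exponent_sum (x : braid_infty) : int := word_exponent_sum (repr x).

Lemma word_exponent_sum_cat u v :
  word_exponent_sum (u ++ v) = (word_exponent_sum u + word_exponent_sum v)%R.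
Proof. by rewrite /word_exponent_sum big_cat. Qed.

Lemma word_exponent_sum_eq n u v :
  braid_eq n u v -> word_exponent_sum u = word_exponent_sum v.
Proof.
elim=> {u v} //.
- by move=> u v w _ -> _ ->.
- by move=> u u' v v' _ e _ e'; rewrite !word_exponent_sum_cat e e'.
- by move=> i [] _; rewrite /word_exponent_sum !big_cons big_nil.
- by move=> i j _ _; rewrite /word_exponent_sum !big_cons big_nil.
- by move=> i _; rewrite /word_exponent_sum !big_cons big_nil.
Qed.

Lemma exponent_sum_class w : exponent_sum (braid_class w) = word_exponent_sum w.
Proof.
have /braid_classP[n /word_exponent_sum_eq //] :
  braid_class (repr (braid_class w)) = braid_class w by rewrite braid_class_repr.
Qed.

Lemma exponent_sum1 : exponent_sum 1 = 0%R.
Proof. by rewrite [LHS]exponent_sum_class /word_exponent_sum big_nil. Qed.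

Lemma exponent_sumM x y :
  exponent_sum (x * y) = (exponent_sum x + exponent_sum y)%R.
Proof.
by rewrite -{1}(braid_class_repr x) -{1}(braid_class_repr y) -braid_class_cat
  exponent_sum_class word_exponent_sum_cat.
Qed.

Lemma exponent_sumV x : exponent_sum x^-1 = (- exponent_sum x)%R.
Proof.
by apply/eqP; rewrite -addr_eq0 -exponent_sumM mulVg exponent_sum1.
Qed.

Lemma exponent_sum_comm f g : exponent_sum (comm f g) = 0%R.
Proof.
rewrite /comm !exponent_sumM !exponent_sumV.
by rewrite [(exponent_sum f + _)%R]addrC addrK addrN.
Qed.

Lemma exponent_sum_sigmaX i m : exponent_sum (sigma i ^+ m) = m%:R%R.
Proof.
elim: m => [|m IH]; first exact: exponent_sum1.
rewrite expgS exponent_sumM IH exponent_sum_class.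
by rewrite /word_exponent_sum big_cons big_nil addr0 -natr1 addrC.
Qed.

Lemma exponent_sum_comm_subgroup x : comm_subgroup x -> exponent_sum x = 0%R.
Proof.
move=> /(_ [set y | exponent_sum y = 0%R]%classic); apply; split.
- split=> /= [|f g f0 g0|f f0]; first exact: exponent_sum1.
  + by rewrite exponent_sumM f0 g0 addr0.
  + by rewrite exponent_sumV f0 oppr0.
- by move=> _ [f [g ->]]; exact: exponent_sum_comm.
Qed.

(** * Differences of conjugates as products of commutators *)

Definition sigma_comms : set braid_infty :=
  [set h | exists f g, h = comm (sigma 0 ^ f) (sigma 0 ^ g)]%classic.

Lemma sigma_comms_conj_closed : conj_closed sigma_comms.
Proof. by move=> _ h [f [g ->]]; exists (f * h), (g * h); rewrite commJ !conjgM. Qed.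

Lemma sigma_comms_inv_closed : inv_closed sigma_comms.
Proof. by move=> _ [f [g ->]]; exists g, f; rewrite commVE. Qed.

Lemma sigma_comms_succ i : sigma_comms (sigma i * (sigma i.+1)^-1).
Proof.
have [g sg] := sigma_conj i; have {}sg : sigma i = sigma 0 ^ g^-1.
  by rewrite conjgE invgK mulgA.
(* With [s = sigma i] and [t = sigma i.+1], the identity is [s * t^-1 = comm s (s ^ t)]. *)
exists g^-1, (g^-1 * sigma i.+1); rewrite conjgM -sg conjgE /comm !invgM invgK.
set s := sigma i; set t := sigma i.+1.
have e : s^-1 * t^-1 * s^-1 = t^-1 * s^-1 * t^-1.
  by apply: invg_inj; rewrite !invgM !invgK !mulgA sigma_artin.
have -> : s * (t^-1 * (s * t)) * s^-1 * (t^-1 * s^-1 * t) =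
    s * t^-1 * s * t * (s^-1 * t^-1 * s^-1) * t by rewrite !mulgA.
by rewrite e !mulgA mulgVK mulgK mulgK.
Qed.

Lemma sigma_comms_diff g :
  prod_length sigma_comms 4 (sigma 0 * (sigma 0 ^ g)^-1).
Proof.
have [N gN] := braid_sub_exists g.
(* The braid [u] fixes [sigma 0] and sends [sigma 2] to [s], which commutes with [g]. *)
have [u [u1 u2]] := shift 2 1 N; set s := sigma (2 + 0 + N) in u2.
have sg : s ^ g = s.
  apply/commute_conjg/(commute_braid_sub _ gN) => i iN.
  by apply/commute_sym/sigma_far; rewrite addnC ltn_addr.
have s0 : prod_length sigma_comms 2 (sigma 0 * s^-1).
  have us : sigma 2 ^ u = s := u2 0%N isT.
  rewrite -(u1 0%N isT) -us -conjVg -conjMg.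
  apply: prod_lengthJ; first exact: sigma_comms_conj_closed.
  rewrite -(mulgVK (sigma 1) (sigma 0)) -mulgA.
  by apply: prod_lengthM (prod_length1 _) (prod_length1 _); exact: sigma_comms_succ.
have -> : sigma 0 * (sigma 0 ^ g)^-1 = (sigma 0 * s^-1) * ((sigma 0 * s^-1) ^ g)^-1.
  by rewrite conjMg conjVg sg (invgM (sigma 0 ^ g)) invgK !mulgA mulgVK.
apply: (prod_lengthM s0); apply: prod_lengthV; first exact: sigma_comms_inv_closed.
by apply: prod_lengthJ s0; exact: sigma_comms_conj_closed.
Qed.

Definition sigma_pm : set braid_infty := [set sigma 0; (sigma 0)^-1]%classic.

Lemma sigma_pm_inv_closed : inv_closed sigma_pm.
Proof. by move=> _ [->|->]; [right | left; rewrite invgK]. Qed.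

Lemma sigma_comms_upto_power l x : prod_length (conjugates sigma_pm) l x ->
  exists y m1 m2, prod_length sigma_comms (l * 4) y /\
    x = y * (sigma 0 ^+ m1 * sigma 0 ^- m2).
Proof.
elim=> [|_ {}l {}x [g [k [spm ->]]] _ [y [m1 [m2 [Sy ->]]]]].
  by exists 1, 0%N, 0%N; rewrite !expg0 invg1 !mulg1; split=> //; exact: prod_length0.
have SJ := sigma_comms_conj_closed; set c := sigma 0 in spm *.
have Sg : prod_length sigma_comms 4 (k ^ g * k^-1).
  case: spm => ->.
    by rewrite -[_ * _]invgK invgM invgK; apply/prod_lengthV/sigma_comms_diff/sigma_comms_inv_closed.
  have -> : c^-1 ^ g * c^-1^-1 = (c * (c ^ g)^-1) ^ c.
    by rewrite conjVg invgK [RHS]conjgE !mulgA mulVg mul1g.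
  by apply: prod_lengthJ => //; exact: sigma_comms_diff.
exists (k ^ g * k^-1 * y ^ k^-1).
have Sl : prod_length sigma_comms (l.+1 * 4) (k ^ g * k^-1 * y ^ k^-1).
  by rewrite mulSn; apply/prod_lengthM/prod_lengthJ.
(* The letter [k ^ g] is replaced by [k], which then passes [y] by conjugation and joins the power
   of [sigma 0]. *)
have e z : k ^ g * (y * z) = k ^ g * k^-1 * y ^ k^-1 * (k * z).
  by rewrite [y ^ _]conjgE invgK !mulgA !mulgVK.
case: spm => /= kE.
  exists m1.+1, m2; split=> //; rewrite e; congr (_ * _).
  by rewrite kE expgS mulgA.
exists m1, m2.+1; split=> //; rewrite e; congr (_ * _).
rewrite kE expgSr invgM !mulgA; congr (_ * _).
exact/commuteX/commute_sym/commuteV/commute_refl.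
Qed.

Lemma sigma_comms_word_norm x : comm_subgroup x ->
  prod_length sigma_comms (word_norm x * 4) x.
Proof.
move=> /exponent_sum_comm_subgroup x0.
have [y [m1 [m2 [Sy xE]]]] :=
  sigma_comms_upto_power ((conj_lengthsP _ _ _).1 (word_norm_attained x)).
have y0 : exponent_sum y = 0%R.
  elim: Sy => [|_ l z [f [g ->]] _ IH]; first exact: exponent_sum1.
  by rewrite exponent_sumM IH exponent_sum_comm addr0.
move: x0; rewrite {1}xE !exponent_sumM exponent_sumV !exponent_sum_sigmaX y0 add0r.
move=> /eqP; rewrite subr_eq0 eqr_nat => /eqP m12.
by rewrite {2}xE m12 mulgV mulg1.
Qed.

(** * Comparison of the two norms *)

Lemma min_nat_le (P : set nat) k : P k -> (min_nat P <= k)%N.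
Proof. by move=> Pk; apply: (min_natP _).2 => //; exists k. Qed.

Lemma braid_nu_sigma (R : realType) n g :
  (2 <= n)%N -> (braid_nu R n (sigma 0 ^ g)%g <= 1)%R.
Proof.
move=> n2; rewrite /braid_nu lern1; apply/min_nat_le/conj_lengthsP/prod_length1.
exists g, (sigma 0); split=> //; exists [:: (0%N, false)] => //.
by rewrite /braid_word /= n2.
Qed.

Lemma comm_lengthsP (R : realType) (nu : braid_infty -> R) p q x l :
  comm_lengths nu p q x l <->
  prod_length [set h | exists f g,
    [/\ (nu f <= p)%R, (nu g <= q)%R & h = comm f g]]%classic l x.
Proof.
split=> [[f [g [fg ->]]]|/prod_lengthP[F [SF ->]]].
  apply/prod_lengthP; exists (fun i => comm (f i) (g i)); split=> // i.
  by exists (f i), (g i); have [] := fg i.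
have /choice[fg fgP] : forall i, exists fg, [/\ (nu fg.1 <= p)%R,
    (nu fg.2 <= q)%R & F i = comm fg.1 fg.2].
  by move=> i; have [f [g ?]] := SF i; exists (f, g).
exists (fun i => (fg i).1), (fun i => (fg i).2); split=> [i|].
  by have [] := fgP i.
by apply: eq_bigr => i _; have [] := fgP i.
Qed.

Lemma word_norm_comm (R : realType) (n : nat) (p : R) : (2 <= n)%N ->
  exists M : nat, forall f g, (braid_nu R n f <= p)%R ->
    exists2 j, (j <= M)%N & prod_length (conjugates sigma_pm) j (comm f g).
Proof.
move=> n2; have [g0 g0P] := displacement n.
have SJ := @conjugates_conj_closed _ sigma_pm.
have SV := conjugates_inv_closed sigma_pm_inv_closed.
pose m := word_norm g0.
have Bm k y : braid_sub n k ->
    prod_length (conjugates sigma_pm) (m + m + (m + m)) (comm k y).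
  move=> /g0P -/(_ y)[h]; apply: prod_length_comm_displace => //.
  by apply: prod_lengthJ => //; apply/conj_lengthsP/word_norm_attained.
(* The value of [braid_nu] is a natural number, so [f] has at most [Num.truncn p] factors; each
   contributes [4 m] letters by displacement. *)
exists (Num.truncn p * (m + m + (m + m)))%N => f g fp.
exists (conj_norm (braid_sub n) f * (m + m + (m + m)))%N.
  rewrite leq_mul2r; apply/orP; right.
  by rewrite truncn_ge_nat //; apply: le_trans fp; exact: ler0n.
exact: prod_length_comm SJ Bm ((conj_lengthsP _ _ _).1 (braid_nu_attained f n2)).
Qed.

Theorem theorem1p3 (R : realType) (n : nat) (p q : R)
    (hn : (2 <= n)%N) (hp : (1 <= p)%R) (hq : (1 <= q)%R) :
  exists c C : R,
    [/\ (0 < c)%R, (c <= C)%R &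
      forall alpha : braid_infty, comm_subgroup alpha ->
        (c * (word_norm alpha)%:R <= (cl (braid_nu R n) p q alpha)%:R)%R /\
        ((cl (braid_nu R n) p q alpha)%:R <= C * (word_norm alpha)%:R)%R].
Proof.
have [M MP] := word_norm_comm p hn.
(* The successor keeps [c] positive even if [M] is zero. *)
exists (M.+1%:R^-1)%R, 4%:R%R; split.
- by rewrite invr_gt0 ltr0n.
- by apply: (@le_trans _ _ 1%R); rewrite ?invf_le1 ?ltr0n ?ler1n.
move=> x x0.
(* This length gives the upper bound and also shows that [cl] is attained at [x] rather than being
   the default 0, as the lower bound requires. *)
have clx : comm_lengths (braid_nu R n) p q x (word_norm x * 4)%N.
  apply/comm_lengthsP.
  apply: prod_length_sub (sigma_comms_word_norm x0) => _ [f [g ->]].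
  exists (sigma 0 ^ f), (sigma 0 ^ g); split=> //.
    exact: le_trans (braid_nu_sigma R f hn) hp.
  exact: le_trans (braid_nu_sigma R g hn) hq.
split; last by rewrite -natrM ler_nat mulnC; exact: min_nat_le.
rewrite ler_pdivrMl ?ltr0n // -natrM ler_nat mulnC.
have [|j jle xj] := @prod_length_subst _ _ (conjugates sigma_pm) _ M.+1 _ _
  ((comm_lengthsP _ _ _ _ _).1 (min_natP (ex_intro _ _ clx)).1).
  by move=> _ [f [g [fp _ ->]]]; have [j jM] := MP f g fp; exists j => //; exact: leqW.
by apply: leq_trans jle; apply/min_nat_le/conj_lengthsP.
Qed.
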